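(* Suppose that every finite simple graph $G$ satisfies $S_k(G) \leq B_k(G)$ for all $1 \leq k \leq n(G)$. Then every quiver $G$ satisfies $S_k(G) \leq B_k(G)$ for all $1 \leq k \leq n(G)$.
   Context: A quiver $G$ is a finite undirected graph with $n=n(G)\ge 1$ vertices in which loops (possibly several at the same vertex) and multiple edges between distinct vertices are allowed. $m=m(G)$ is the total number of edges, where every loop and every edge of a multiple connection is counted. A finite simple graph is a quiver with no loops and no multiple connections. The Kirchhoff matrix $K$ of $G$ is the symmetric $n\times n$ matrix with $K_{ij}=-(\text{number of edges between } i \text{ and } j)$ for $i\neq j$, and $K_{ii}=$ the degree of vertex $i$, i.e. the number of edges attached to $i$, counted with multiplicity, where each loop at $i$ counts as $1$. Its eigenvalues are $\lambda_1\ge\lambda_2\ge\dots\ge\lambda_n$, and $S_k(G)=\sum_{j=1}^k\lambda_j$. The redundancy $r=r(G)$ is the minimal number of edges whose removal leaves no multiple connections between distinct vertices; equivalently $r=\sum_{i<j}(\mathrm{sign}(K_{ij})-K_{ij})$ (multiple loops at a vertex do not count as redundant). Set $B_k(G)=m+r+k(k+1)/2$. For a finite simple graph $r=0$, so $B_k(G)=m+k(k+1)/2$. *)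

(* Defs.v *)
From HB Require Import structures.
From mathcomp Require Import all_boot all_order all_algebra.
From mathcomp Require Import reals.
From mathcomp Require Import polyrcf.

Set Implicit Arguments.
Unset Strict Implicit.
Unset Printing Implicit Defensive.

Import Order.TTheory GRing.Theory Num.Theory.

Local Open Scope ring_scope.

(* An edge is sent to the set of its endpoints, which is a singleton exactly
   when the edge is a loop. *)
Record quiver := Quiver {
  num_vertices : nat;
  edge : finType;
  ends : edge -> {set 'I_num_vertices};
  num_vertices_gt0 : (0 < num_vertices)%N;
  card_ends : forall e, (0 < #|ends e| <= 2)%N
}.

Section Quiver.
Variable G : quiver.
Implicit Type F : {set edge G}.

Definition num_edges : nat := #|edge G|.

Definition no_loops : bool := [forall e : edge G, (#|ends e| != 1)%N].

Definition no_multiple_connections F : bool :=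
  [forall i, forall j, (i != j) ==>
     (#|[set e in F | ends e == [set i; j]]| <= 1)%N].

Definition simple_graph : bool := no_loops && no_multiple_connections [set: edge G].

Definition num_connections (i j : 'I_(num_vertices G)) : nat :=
  #|[set e : edge G | ends e == [set i; j]]|.

(* Edges are counted by incidence, so a loop at i contributes 1, not 2. *)
Definition degree (i : 'I_(num_vertices G)) : nat :=
  #|[set e : edge G | i \in ends e]|.

Definition redundancy : nat :=
  #|[arg min_(F < [set: edge G] | no_multiple_connections (~: F)) #|F|]|.

Definition Kirchhoff (R : realType) : 'M[R]_(num_vertices G) :=
  \matrix_(i, j)
    if i == j then (degree i)%:R else - (num_connections i j)%:R.

End Quiver.

(* The real eigenvalues of A in nonincreasing order, each repeated according to
   its multiplicity as a root of the characteristic polynomial; there are n of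
   them when A is symmetric. *)
Definition eigenvalues (R : realType) (n : nat) (A : 'M[R]_n) : seq R :=
  sort >=%R (flatten [seq nseq (mup x (char_poly A)) x
                     | x <- rootsR (char_poly A)]).

Definition eigen_sum (R : realType) (G : quiver) (k : nat) : R :=
  \sum_(j < k) (eigenvalues (Kirchhoff G R))`_j.

Definition edge_bound (G : quiver) (k : nat) : nat :=
  (num_edges G + redundancy G + (k * k.+1) %/ 2)%N.

(* Main.v *)
(* Let G' be the simple graph obtained from G by deleting all loops and a
   minimal set F of edges, |F| = r, leaving no multiple connections.  Since K is
   the sum over the edges e of rank-one matrices w_e^T w_e, we have
   K(G) = K(G') + P with P positive semidefinite, and tr P counts 1 for each
   deleted loop and 2 for each other deleted edge, hence is at most m - m' + r.
   By Ky Fan's maximum principle, adding P raises the sum of the k largest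
   eigenvalues by at most tr P, so S_k(G) <= B_k(G') + tr P <= B_k(G). *)
Require Import Defs.
From mathcomp Require Import all_boot all_order all_fingroup all_algebra.
From mathcomp Require Import reals polyrcf complex.

Set Implicit Arguments.
Unset Strict Implicit.
Unset Printing Implicit Defensive.

Import Order.TTheory GRing.Theory Num.Theory.

Local Open Scope ring_scope.
Local Open Scope complex_scope.
Local Open Scope sesquilinear_scope.

(** * Spectral theorem for real symmetric matrices *)

(** Both lists contain each [x] exactly [mup x (char_poly A)] times. *)
Lemma perm_eigenvalues (R : realType) n (A : 'M[R]_n) (s : seq R) :
  char_poly A = \prod_(x <- s) ('X - x%:P) -> perm_eq (eigenvalues A) s.
Proof.
move=> charA; rewrite perm_sort; set p := char_poly A.
have p0 : p != 0 by rewrite monic_neq0 // char_poly_monic.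
have mupE x : mup x p = count_mem x s by rewrite /p charA mu_prod_XsubC.
apply/allP => x _ /=; rewrite -mupE count_flatten sumnE -map_comp big_map.
under eq_bigr do rewrite /= count_nseq /=.
have uniq_roots : uniq (rootsR p) by apply: uniq_roots.
have [x_root|x_nroot] := boolP (root p x).
  have x_in : x \in rootsR p.
    by have:= roots_on_rootsR p0 x; rewrite x_root in_itv => /esym.
  rewrite (bigD1_seq x) //= eqxx mul1n big1 ?addn0 // => y /negbTE.
  by move=> ->.
rewrite (mupNroot x_nroot) big1 // => y _.
by have [->|//] := eqVneq y x; rewrite (mupNroot x_nroot).
Qed.

Lemma char_poly_similar (F : fieldType) n (P A D : 'M[F]_n) :
  P \in unitmx -> A = invmx P *m D *m P -> char_poly A = char_poly D.
Proof.
move=> Pu ->; rewrite /char_poly /char_poly_mx.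
have Qu : map_mx polyC P \in unitmx.
  by rewrite unitmxE det_map_mx rmorph_unit // -unitmxE.
(* Conjugation fixes the scalar matrix of ['X], so the characteristic matrix of [A] is conjugate to
   that of [D] over the polynomials. *)
rewrite [in LHS](_ : 'X%:M = invmx (map_mx polyC P) *m 'X%:M *m map_mx polyC P
   :> 'M[{poly F}]_n); last by rewrite scalar_mxC -mulmxA mulVmx // mulmx1.
have PV : map_mx polyC (invmx P) = invmx (map_mx polyC P).
  by rewrite -[LHS](mulmxK Qu) -map_mxM mulVmx // map_mx1 mul1mx.
rewrite !map_mxM PV -mulmxBl -mulmxBr !det_mulmx mulrAC -det_mulmx.
by rewrite mulVmx // det1 mul1r.
Qed.

Lemma char_poly_diag (F : comNzRingType) n (d : 'rV[F]_n) :
  char_poly (diag_mx d) = \prod_i ('X - (d 0 i)%:P).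
Proof.
rewrite char_poly_trig; last exact: diag_mx_is_trig.
by apply: eq_bigr => i _; rewrite !mxE eqxx mulr1n.
Qed.

(** Over [R[i]] the matrix is hermitian, hence unitarily diagonalizable with real diagonal;
    permuting the rows of the unitary matrix puts that diagonal in the order of [eigenvalues A]. *)
Lemma symmetric_spectral (R : realType) n (A : 'M[R]_n) : A^T = A ->
  size (eigenvalues A) = n /\
  exists2 V : 'M[R[i]]_n, V \is unitarymx &
    V *m map_mx (real_complex R) A *m V ^t* =
    map_mx (real_complex R) (diag_mx (\row_j (eigenvalues A)`_j)).
Proof.
move=> Asym; set B := map_mx _ A.
have Bherm : B \is hermsymmx.
  apply: realsym_hermsym.
    apply/is_hermitianmxP; rewrite expr0 scale1r map_mx_id //.
    by rewrite /B map_trmx Asym.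
  by apply/mxOverP => i j; rewrite mxE complex_real.
have /orthomx_spectralP := hermitian_normalmx Bherm.
have Dreal := hermitian_spectral_diag_real Bherm.
have Uunit := spectral_unitarymx B.
set U := spectralmx B in Uunit *; set D := spectral_diag B in Dreal * => BE.
pose d i := complex.Re (D 0 i).
have dE i : (d i)%:C = D 0 i by apply: RRe_real; move: Dreal => /mxOverP.
have charA : char_poly A = \prod_(x <- [tuple d i | i < n]) ('X - x%:P).
  (* The factorization is obtained over [R[i]] and descends to [R] by injectivity of the
     embedding. *)
  apply: (map_poly_inj (real_complex R)).
  rewrite map_char_poly (char_poly_similar (unitarymx_unit Uunit) BE).
  rewrite char_poly_diag rmorph_prod /= big_map enumT.
  rewrite /index_enum; apply: eq_bigr => i _.
  by rewrite rmorphB /= map_polyX map_polyC /= dE.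
have /perm_eigenvalues/tuple_permP[p eigE] := charA.
split; first by rewrite eigE size_tuple.
have row_permM M i j : (row_perm p U *m M *m (row_perm p U) ^t*) i j
    = (U *m M *m U ^t*) (p i) (p j).
  rewrite !mxE; apply: eq_bigr => k _; rewrite !mxE; congr (_ * _).
  by apply: eq_bigr => l _; rewrite !mxE.
exists (row_perm p U).
  apply/unitarymxP/matrixP => i j; have := row_permM 1%:M i j.
  by rewrite !mulmx1 => ->; rewrite (unitarymxP Uunit) !mxE (inj_eq perm_inj).
apply/matrixP => i j; rewrite row_permM BE -invmx_unitary // !mulmxA.
rewrite mulmxV ?unitarymx_unit // mul1mx mulmxK ?unitarymx_unit // !mxE (inj_eq perm_inj) eigE.
by case: eqP => // _; rewrite !mulr1n -dE -tnth_nth !tnth_mktuple.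
Qed.

(** * Ky Fan's maximum principle *)

(* The slack is the sum of (s_i - s_(k-1)) (w_i - [i < k]), all nonpositive. *)
Lemma sum_weights_le_top (F : numDomainType) (n k : nat) (s : nat -> F)
    (w : 'I_n -> F) :
  (forall i j, (i <= j < n)%N -> s j <= s i) -> (k <= n)%N ->
  (forall i, 0 <= w i <= 1) -> \sum_i w i = k%:R ->
  \sum_(i < n) s i * w i <= \sum_(j < k) s j.
Proof.
(* When [k] is 0, [k.-1] truncates to 0 and [c] is [s 0], which still dominates every [s i]. *)
move=> s_decr le_kn w01 sumw; pose c := s k.-1.
pose b (i : 'I_n) : F := (i < k)%:R.
have sumb (f : nat -> F) : \sum_(i < n) f i * b i = \sum_(j < k) f j.
  rewrite (big_ord_widen _ _ le_kn) [RHS]big_mkcond.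
  by apply: eq_bigr => i _; rewrite /b; case: ltnP; rewrite ?mulr1 ?mulr0.
have sumb1 : \sum_i b i = k%:R.
  have := sumb (fun=> 1); rewrite sumr_const card_ord => <-.
  by apply: eq_bigr => i _; rewrite mul1r.
have le_term (i : 'I_n) : s i * w i <= s i * b i + c * (w i - b i).
  have /andP[w0 w1] := w01 i; rewrite addrC -lerBlDr -mulrBr /b.
  have [lt_ik|le_ki] := ltnP i k.
    rewrite ler_wnM2r ?subr_le0 // s_decr //.
    by case: (k) lt_ik le_kn => // k' le_ik' ->; rewrite -ltnS le_ik'.
  rewrite subr0 ler_wpM2r // s_decr // (ltn_ord i) andbT.
  exact: leq_trans (leq_pred k) le_ki.
apply: le_trans (ler_sum _ (fun i _ => le_term i)) _.
by rewrite big_split /= sumb -mulr_sumr sumrB sumw sumb1 subrr mulr0 addr0.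
Qed.

Lemma unitarymx_sqr_sum1 (C : numClosedFieldType) n (V : 'M[C]_n) i :
  V \is unitarymx -> \sum_j V i j * (V i j)^* = 1.
Proof.
move=> /unitarymxP/matrixP/(_ i i); rewrite !mxE eqxx mulr1n => <-.
by apply: eq_bigr => j _; rewrite !mxE.
Qed.

(* In an eigenbasis of A the left side is a sum of the eigenvalues of A weighted
   by column sums of the doubly stochastic matrix |M j i|^2. *)
Lemma sum_diag_le_eigenvalues (R : realType) n k (A : 'M[R]_n)
    (V : 'M[R[i]]_n) :
  A^T = A -> V \is unitarymx -> (k <= n)%N ->
  \sum_(j < n | (j < k)%N) (V *m map_mx (real_complex R) A *m V ^t*) j j
    <= \sum_(j < k) ((eigenvalues A)`_j)%:C.
Proof.
move=> Asym Vunit le_kn; set B := map_mx _ A.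
have [size_eig [U Uunit UE]] := symmetric_spectral Asym.
set D := map_mx _ (diag_mx _) in UE; pose M := V *m U ^t*.
have Munit : M \is unitarymx by rewrite mul_unitarymx ?trmxC_unitary.
have BE : B = U ^t* *m D *m U.
  rewrite -UE -/B -invmx_unitary // !mulmxA mulVmx ?unitarymx_unit //.
  by rewrite mul1mx mulmxKV ?unitarymx_unit.
have {BE} -> : V *m B *m V ^t* = M *m D *m M ^t*.
  by rewrite BE /M trmx_mul map_mxM /= trmxCK !mulmxA.
pose s j := ((eigenvalues A)`_j)%:C.
have diagE j : (M *m D *m M ^t*) j j = \sum_(i < n) s i * (M j i * (M j i)^*).
  rewrite /D map_diag_mx mul_mx_diag !mxE; apply: eq_bigr => i _.
  by rewrite !mxE -mulrA mulrCA.
rewrite (eq_bigr _ (fun j _ => diagE j)) exchange_big /=.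
under eq_bigr do rewrite -mulr_sumr.
apply: sum_weights_le_top => //.
- move=> i j /andP[le_ij lt_jn]; rewrite lecR.
  have eig_sorted : sorted >=%R (eigenvalues A).
    by apply: sort_sorted => x y; apply: ge_total.
  apply: (sorted_leq_nth ge_trans ge_refl) => //.
  + by rewrite inE size_eig (leq_ltn_trans le_ij).
  + by rewrite inE size_eig.
- move=> i; rewrite sumr_ge0 => [|j _]; last exact: mul_conjC_ge0.
  (* The weight is part of a full column sum of squared moduli, which is 1 because [M^T] is
     unitary. *)
  rewrite -(@unitarymx_sqr_sum1 _ _ M^T i) ?trmx_unitary //=.
  rewrite [leRHS](bigID (fun j : 'I_n => (j < k)%N)) /=.
  under [X in X + _]eq_bigr do rewrite mxE.
  by rewrite lerDl sumr_ge0 // => j _; apply: mul_conjC_ge0.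
- rewrite exchange_big /=.
  under eq_bigr do rewrite unitarymx_sqr_sum1 //.
  by rewrite -(big_ord_widen _ (fun=> 1) le_kn) sumr_const card_ord.
Qed.

(** In an eigenbasis of [A + P] the left side is a sum of [k] diagonal entries. The share of [A] is
    bounded by Ky Fan, that of [P] by its whole trace, the other diagonal entries being nonnegative.
    Positivity is required on complex vectors because the eigenbasis is complex. *)
Lemma eigenvalue_sum_add_psd (R : realType) n k (A P : 'M[R]_n) :
  A^T = A -> P^T = P ->
  (forall x : 'rV[R[i]]_n,
     0 <= (x *m map_mx (real_complex R) P *m x ^t*) 0 0) ->
  (k <= n)%N ->
  \sum_(j < k) (eigenvalues (A + P))`_j
    <= \sum_(j < k) (eigenvalues A)`_j + \tr P.
Proof.
move=> Asym Psym Ppsd le_kn; rewrite -lecR rmorphD /= !rmorph_sum /=.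
have APsym : (A + P)^T = A + P by rewrite linearD /= Asym Psym.
have [_ [V Vunit VE]] := symmetric_spectral APsym.
have top : \sum_(j < k) ((eigenvalues (A + P))`_j)%:C = \sum_(j < n | (j < k)%N)
    (V *m map_mx (real_complex R) (A + P) *m V ^t*) j j.
  rewrite VE (big_ord_widen _ (fun j => ((eigenvalues (A + P))`_j)%:C) le_kn).
  by apply: eq_bigr => j _; rewrite !mxE eqxx mulr1n.
rewrite {}top map_mxD mulmxDr mulmxDl.
rewrite (eq_bigr _ (fun j _ => mxE _ _ j j)).
rewrite big_split /= lerD ?sum_diag_le_eigenvalues //.
have -> : \sum_i (P i i)%:C = \tr (V *m map_mx (real_complex R) P *m V ^t*).
  rewrite mxtrace_mulC mulmxA -invmx_unitary // mulVmx ?unitarymx_unit //.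
  by rewrite mul1mx; apply: eq_bigr => i _; rewrite mxE.
rewrite [leRHS](bigID (fun j : 'I_n => (j < k)%N)) /= lerDl sumr_ge0 // => j _.
(* The [j]-th diagonal entry is the quadratic form of [P] at row [j] of [V]. *)
have := Ppsd (row j V); rewrite -row_mul => /le_trans; apply.
by rewrite !mxE le_eqVlt; apply/orP/or_introl/eqP/eq_bigr => i _; rewrite !mxE.
Qed.

(** * Incidence vectors and the Kirchhoff matrix *)

(* A row of an incidence matrix, oriented so that [edge_vec s] only depends on
   the set of endpoints s. *)
Definition edge_vec (R : realType) n (s : {set 'I_n}) : 'rV[R]_n :=
  \row_i if i \in s then if [pick j in s] == Some i then 1 else -1 else 0.

(** Of two distinct endpoints exactly one is picked, so their signs are opposite and the product is
    -1. *)
Lemma edge_vecM (R : realType) n (s : {set 'I_n}) i j : (#|s| <= 2)%N ->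
  edge_vec R s 0 i * edge_vec R s 0 j =
  if i == j then (i \in s)%:R else - (s == [set i; j])%:R.
Proof.
move=> s_le2; rewrite !mxE; have [->|neq_ij] := eqVneq i j.
  by case: ifP; [case: ifP|]; rewrite ?mulr1 ?mulrNN ?mulr1 ?mulr0.
have [sE|s_neq] := eqVneq s [set i; j].
  rewrite {1 3}sE !inE !eqxx orbT /=.
  case: pickP => [x|/(_ i)]; last by rewrite sE !inE eqxx.
  rewrite sE !inE => /orP[]/eqP->; rewrite !(inj_eq Some_inj) eqxx.
    by rewrite (negbTE neq_ij) mul1r.
  by rewrite eq_sym (negbTE neq_ij) mulr1.
have [i_s|_] := boolP (i \in s); last by rewrite mul0r oppr0.
have [j_s|_] := boolP (j \in s); last by rewrite mulr0 oppr0.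
(* Two distinct members of a set of at most two elements exhaust it. *)
case/negP: s_neq; rewrite eq_sym eqEcard cards2 neq_ij s_le2 andbT.
by apply/subsetP => x; rewrite !inE => /orP[]/eqP->.
Qed.

(** Loops fit because their vector has a single nonzero entry, of square 1, matching their
    contribution to [degree]. *)
Lemma KirchhoffE (R : realType) (G : quiver) :
  Kirchhoff G R =
  \sum_(e : edge G) (edge_vec R (ends e))^T *m edge_vec R (ends e).
Proof.
apply/matrixP => i j; rewrite summxE mxE.
have card_le2 e : (#|@ends G e| <= 2)%N by have /andP[] := card_ends e.
under eq_bigr do rewrite mxE big_ord1 mxE edge_vecM //.
rewrite /degree /num_connections.
case: eqP => _; rewrite -sum1_card natr_sum big_mkcond /=.
  by apply: eq_bigr => e _; rewrite inE; case: (i \in _).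
rewrite -sumrN; apply: eq_bigr => e _; rewrite inE.
by case: eqP => _; rewrite ?oppr0.
Qed.

Lemma tr_edge_vec (R : realType) n (s : {set 'I_n}) : (#|s| <= 2)%N ->
  \tr ((edge_vec R s)^T *m edge_vec R s) = #|s|%:R.
Proof.
move=> s_le2; rewrite -sum1_card natr_sum big_mkcond; apply: eq_bigr => i _.
by rewrite !mxE big_ord1 [_^T _ _]mxE edge_vecM // eqxx; case: (i \in s).
Qed.

(** Since [w] is real, the form is the squared modulus of the scalar [x *m w^T]. *)
Lemma gram_psd (R : realType) n (w x : 'rV_n) :
  0 <= (x *m map_mx (real_complex R) (w^T *m w) *m x ^t*) 0 0.
Proof.
have -> : x *m map_mx (real_complex R) (w^T *m w) *m x ^t* =
    (x *m map_mx (real_complex R) w^T)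
      *m (x *m map_mx (real_complex R) w^T) ^t*.
  rewrite trmx_mul !map_mxM /= !mulmxA; congr (_ *m _ *m _).
  apply/matrixP => i j; rewrite !mxE; apply/esym/CrealP.
  by rewrite complex_real.
by rewrite mxE big_ord1 !mxE mul_conjC_ge0.
Qed.

(** * Deleting edges, redundancy, and the reduction to simple graphs *)

Section Subquiver.
Variables (G : quiver) (S : {set edge G}).

(** All vertices are kept, so both Kirchhoff matrices have the same type and the range of [k] is
    unchanged. *)
Definition subquiver : quiver :=
  @Quiver (num_vertices G) {e | e \in S} (fun e => ends (val e))
    (num_vertices_gt0 G) (fun e => card_ends (val e)).

Lemma Kirchhoff_subquiver (R : realType) :
  Kirchhoff G R = Kirchhoff subquiver R +
  \sum_(e in ~: S) (edge_vec R (ends e))^T *m edge_vec R (ends e).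
Proof.
rewrite !KirchhoffE (bigID (mem S)) /= big_sub; congr (_ + _).
by apply: eq_bigl => e; rewrite inE.
Qed.

Lemma simple_subquiver : no_multiple_connections S ->
  (forall e, e \in S -> #|ends e| != 1%N) -> simple_graph subquiver.
Proof.
move=> /forallP noS loopS; apply/andP; split.
  by apply/forallP => -[e eS]; apply: loopS.
apply/forallP => i; apply/forallP => j; apply/implyP => neq_ij.
have /forallP/(_ j)/implyP/(_ neq_ij) := noS i; apply: leq_trans.
rewrite -(card_imset _ val_inj) subset_leq_card //.
apply/subsetP => _ /imsetP[[e eS] + ->] /=.
by rewrite !inE /= eS.
Qed.

End Subquiver.

(** Makes [[set: edge G]] admissible in the [arg min] of [redundancy], which is therefore a genuine
    minimum. *)
Lemma no_multiple_connections0 (G : quiver) :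
  no_multiple_connections (set0 : {set edge G}).
Proof.
apply/forallP => i; apply/forallP => j; apply/implyP => _.
by rewrite (eq_card0 (A := [set _ in _ | _])) // => e; rewrite !inE.
Qed.

Lemma simple_redundancy (G : quiver) : simple_graph G -> redundancy G = 0%N.
Proof.
case/andP=> _ simpleG; rewrite /redundancy; case: arg_minnP => [|F _ /(_ set0)].
  by rewrite setCT no_multiple_connections0.
by rewrite setC0 cards0 leqn0 => /(_ simpleG)/eqP.
Qed.

Lemma redundancy_set (G : quiver) :
  {F : {set edge G} | no_multiple_connections (~: F) & #|F| = redundancy G}.
Proof.
rewrite /redundancy; case: arg_minnP => [|F noF _]; last by exists F.
by rewrite setCT no_multiple_connections0.
Qed.

Theorem theorem2 (R : realType) :
  (forall G : quiver, simple_graph G ->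
     forall k : nat, (1 <= k <= num_vertices G)%N ->
     eigen_sum R G k <= (edge_bound G k)%:R) ->
  forall G : quiver,
     forall k : nat, (1 <= k <= num_vertices G)%N ->
     eigen_sum R G k <= (edge_bound G k)%:R.
Proof.
move=> simple_bound G k k_range; have /andP[_ le_kn] := k_range.
have [F noF cardF] := redundancy_set G.
pose S := [set e in ~: F | #|ends e| != 1%N].
have simpleS : simple_graph (subquiver S).
  apply: simple_subquiver => [|e]; last by rewrite inE => /andP[].
  apply/forallP => i; apply/forallP => j; apply/implyP => neq_ij.
  have /forallP/(_ i)/forallP/(_ j)/implyP/(_ neq_ij) := noF; apply: leq_trans.
  apply/subset_leq_card/subsetP => e; rewrite !inE.
  by case/andP => /andP[-> _] ->.
have := simple_bound _ simpleS _ k_range.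
rewrite /edge_bound (simple_redundancy simpleS) addn0 => boundS.
pose P := \sum_(e in ~: S) (edge_vec R (ends e))^T *m edge_vec R (ends e).
have trP : \tr P <= (#|~: S| + redundancy G)%:R.
  have -> : \tr P = (\sum_(e in ~: S) #|ends e|)%:R.
    rewrite raddf_sum natr_sum; apply: eq_bigr => e _.
    by rewrite /= tr_edge_vec //; have /andP[] := card_ends e.
  (* Each deleted edge is charged 1, plus 1 more if it lies in [F]: this covers two endpoints in
     [F], and a deleted edge outside [F] is a loop with only one. *)
  rewrite ler_nat -cardF -!sum1_card [X in (_ + X)%N]big_mkcond /=.
  rewrite [X in (_ + X)%N](bigID (mem (~: S))) /= addnA -big_split /=.
  apply: leq_trans (leq_addr _ _); apply: leq_sum => e.
  rewrite !inE negb_and !negbK; case: ifP => [_ _|_ /= /eqP-> //].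
  by have /andP[] := card_ends e.
have Psym : P^T = P.
  by rewrite raddf_sum; apply: eq_bigr => e _; rewrite /= trmx_mul trmxK.
have Ssym : (Kirchhoff (subquiver S) R)^T = Kirchhoff (subquiver S) R.
  rewrite KirchhoffE raddf_sum; apply: eq_bigr => e _.
  by rewrite /= trmx_mul trmxK.
rewrite /eigen_sum (Kirchhoff_subquiver S) -/P.
apply: le_trans (eigenvalue_sum_add_psd Ssym Psym _ le_kn) _.
  move=> x; rewrite map_mx_sum mulmx_sumr mulmx_suml summxE sumr_ge0 // => e _.
  exact: gram_psd.
apply: le_trans (lerD boundS trP) _; rewrite -natrD ler_nat.
(* Kept and deleted edges together number [num_edges G], so the two sides are equal. *)
rewrite [num_edges (subquiver S)]card_sig [num_edges G]/num_edges -(cardsC S).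
by rewrite addnAC addnA addnAC.
Qed.
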